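(* Formulation F6 is strictly tighter than Formulation F5 (both defined in the context). Explicitly, writing $X(S)_{t,m}=\sum_{t'=t-W_m+1}^{t}S_{t',m}$ for $t\in T$, $m\in M$: (i) for every instance $(T,M,(W_m)_{m\in M})$ and every continuous solution $S$ of F6, $X(S)$ is a continuous solution of F5; and (ii) there exist an instance and a continuous solution $X$ of F5 for that instance such that there is no continuous solution $S$ of F6 with $X(S)=X$.
   Context: An instance of the generator maintenance scheduling problem consists of a horizon $T=\{1,2,\dots,|T|\}$ of periods, a finite nonempty set $M$ of maintenances, and a positive integer duration $W_m$ for each $m\in M$. The variables are $X_{t,m}$ (maintenance $m$ is executed in period $t$) and $S_{t,m}$ (maintenance $m$ starts in period $t$), for $t\in T$, $m\in M$. Conventions: $X_{t,m}=0$ whenever $t\le 0$ or $t>|T|$; $S_{t,m}=0$ whenever $t\le 0$, $t>|T|$, or $t\ge |T|-W_m+2$ (a maintenance cannot start so late that it would not finish within the horizon). In particular every solution involving $S$ is required to satisfy $S_{t,m}=0$ for $t\in T$ with $t\ge |T|-W_m+2$. Formulation F5 (variables $X$ only): $\sum_{t\in T}X_{t,m}=W_m$ for all $m\in M$; $W_m\,(X_{t,m}-X_{t-1,m})\le \sum_{t'=t}^{t+W_m-1}X_{t',m}$ for all $t\in T$, $m\in M$; $X_{t,m}\in\{0,1\}$ for all $t\in T$, $m\in M$. Formulation F6 (variables $S$ only): $\sum_{t\in T}S_{t,m}=1$ for all $m\in M$; $S_{t,m}\in\{0,1\}$ for all $t\in T$, $m\in M$. In F6 the execution variable is not explicit: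 the expression $\sum_{t'=t-W_m+1}^{t}S_{t',m}$ is used wherever $X_{t,m}$ would appear. A continuous solution of a formulation is a real assignment of its variables satisfying its linear relaxation, i.e. all its constraints with each condition ''$\in\{0,1\}$'' replaced by ''$\in[0,1]$''. A formulation A is at least as tight as B if all continuous solutions satisfying A also satisfy B; A is strictly tighter than B if A is at least as tight as B and there is at least one continuous solution satisfying B that does not satisfy A. The comparison is made in terms of $X$, with $X$ in F6 given by the expression above. *)

(* Defs.v *)
From HB Require Import structures.
From mathcomp Require Import all_boot all_order all_algebra.
From mathcomp Require Import reals.

Set Implicit Arguments.
Unset Strict Implicit.
Unset Printing Implicit Defensive.

Import Order.TTheory GRing.Theory Num.Theory.
Local Open Scope ring_scope.

Record instance := Instance {
  horizon : nat;
  maintenance : finType;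
  maintenance_nonempty : (0 < #|maintenance|)%N;
  duration : maintenance -> nat;
  duration_gt0 : forall m, (0 < duration m)%N }.

Definition period (I : instance) (t : nat) : bool := (1 <= t <= horizon I)%N.

(* Only the values at periods of [I] are variables of the model; the formulations
   below never depend on the other ones. *)
Definition assignment (R : realType) (I : instance) : Type :=
  nat -> maintenance I -> R.

Section Formulations.
Variable R : realType.

(* The convention that variables vanish outside the horizon. *)
Definition padded (I : instance) (Y : assignment R I) : assignment R I :=
  fun t m => if period I t then Y t m else 0.

(* A formulation is parametrized by the domain imposed on each variable: {0, 1}
   for the formulation itself, [0, 1] for its linear relaxation. *)
Definition formulation : Type :=
  pred R -> forall I : instance, assignment R I -> Prop.

Definition unit_interval : pred R := [pred x | 0 <= x <= 1].

Definition continuous_solution (A : formulation) (I : instance)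
  (Y : assignment R I) : Prop := A unit_interval I Y.

Definition F5 : formulation := fun dom I X =>
  [/\ forall m : maintenance I,
        \sum_(1 <= t < (horizon I).+1) X t m = (duration m)%:R,
      forall (t : nat) (m : maintenance I), period I t ->
        (duration m)%:R * (X t m - padded X t.-1 m)
          <= \sum_(t <= t' < t + duration m) padded X t' m
    & forall (t : nat) (m : maintenance I), period I t -> dom (X t m)].

(* The second clause is the convention S_{t,m} = 0 for t >= |T| - W_m + 2,
   rearranged because subtraction on [nat] is truncated. *)
Definition F6 : formulation := fun dom I S =>
  [/\ forall m : maintenance I, \sum_(1 <= t < (horizon I).+1) S t m = 1,
      forall (t : nat) (m : maintenance I), period I t ->
        (horizon I + 2 <= t + duration m)%N -> S t m = 0
    & forall (t : nat) (m : maintenance I), period I t -> dom (S t m)].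

(* The sum of S_{t',m} over t - W_m + 1 <= t' <= t. When t - W_m + 1 < 0 the
   truncated subtraction starts the sum at 0, which only drops terms with t' < 0;
   these are zero by convention, as is the term t' = 0. *)
Definition execution (I : instance) (S : assignment R I) : assignment R I :=
  fun t m => \sum_(t.+1 - duration m <= t' < t.+1) padded S t' m.

Definition F6_in_X : formulation := fun dom I X =>
  exists S : assignment R I, F6 dom S /\
    forall (t : nat) (m : maintenance I), period I t -> execution S t m = X t m.

Definition at_least_as_tight (A B : formulation) : Prop :=
  forall (I : instance) (X : assignment R I),
    continuous_solution A X -> continuous_solution B X.

Definition strictly_tighter (A B : formulation) : Prop :=
  at_least_as_tight A B /\
  exists (I : instance) (X : assignment R I),
    continuous_solution B X /\ ~ continuous_solution A X.

End Formulations.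

(* Main.v *)
Require Import Defs.
From mathcomp Require Import all_boot all_order all_algebra.
From mathcomp Require Import reals.
From mathcomp Require Import zify lra.

(** A solution S of the relaxed F6 is, for each maintenance m, a convex
    combination of start periods: S_u is the weight of the schedule that runs m
    during [u, u + W_m), and this interval lies inside the horizon whenever
    S_u is nonzero.  The execution variable X_t is then the total weight of the
    starts u with u <= t < u + W_m ([execution_by_start]).  Being an average of
    integral schedules, X sums to W_m and takes its values in [0, 1].  For the
    remaining constraints of F5, the starts that count at t but not at t - 1
    reduce to t itself, so that X_t - X_(t-1) <= S_t, while S_t is a part of
    each of the W_m terms X_t, ..., X_(t + W_m - 1).

    The inclusion is strict because F5 constrains the total and the increments
    of X, which does not force X to be an average of schedules.  With three
    periods and one maintenance of duration 2, F6 allows the starts 1 and 2 only,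
    and both execute the maintenance in period 2, so that X_2 = 1; the flat
    profile (2/3, 2/3, 2/3) nevertheless satisfies F5. *)

Set Implicit Arguments.
Unset Strict Implicit.
Unset Printing Implicit Defensive.

Import Order.TTheory GRing.Theory Num.Theory.
Local Open Scope ring_scope.

(** * Execution profiles of F6 satisfy F5 *)

Section StartToExecution.
Variables (R : realType) (I : instance) (S : assignment R I).

(** Here the window is a condition on starts, not a range with truncated bounds,
    so profiles at different periods become sums over the same range and
    can be compared term by term. *)
Lemma execution_by_start t m :
  execution S t m =
    \sum_(1 <= u < (horizon I).+1 | (u <= t < u + duration m)%N) S u m.
Proof.
(* Both sides are sums of padded values over the common range [0, N). *)
pose N := (t.+1 + (horizon I).+1)%N.
rewrite /execution (big_nat_widen _ _ N) ?leq_addr //.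
rewrite (big_nat_widenl _ 0%N) //.
rewrite [RHS](big_nat_widen _ _ N) ?leq_addl //.
rewrite [RHS](big_nat_widenl _ 0%N) //.
rewrite big_mkcond [RHS]big_mkcond; apply: eq_bigr => u _.
rewrite /padded /period /=.
have := duration_gt0 m.
by do !case: ifP => //; lia.
Qed.

Hypothesis solS : continuous_solution (@F6 R) S.

Lemma start_ge0 u m : period I u -> 0 <= S u m.
Proof. by case: solS => _ _ dom /(dom _ m) /andP[]. Qed.

Lemma start_fits u m :
  period I u -> S u m != 0 -> (u + duration m <= (horizon I).+1)%N.
Proof.
case: solS => _ late _ Iu; apply: contraNT; rewrite -ltnNge => lt_late.
by apply/eqP/late => //; rewrite addn2.
Qed.

(** No start that satisfies the end-of-horizon convention is still running after
    the horizon, so the padding in F5 leaves an execution profile unchanged. *)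
Lemma padded_execution t m : padded (execution S) t m = execution S t m.
Proof.
rewrite /padded; case: ifPn => // outI; rewrite execution_by_start.
rewrite big_nat_cond big1 // => u /andP[Iu /andP[le_ut lt_t]].
have pu : period I u by rewrite /period -ltnS.
apply/eqP; apply: contraNT outI => /(start_fits pu) fits.
rewrite /period; lia.
Qed.

Lemma execution_ge0 t m : 0 <= execution S t m.
Proof.
rewrite execution_by_start big_nat_cond.
by apply: sumr_ge0 => u /andP[Iu _]; apply: start_ge0.
Qed.

Lemma execution_le1 t m : execution S t m <= 1.
Proof.
case: solS => /(_ m) <- _ _; rewrite execution_by_start big_mkcond.
apply: ler_sum_nat => u Iu.
by case: ifP => // _; apply: start_ge0.
Qed.

(** Exchanging the two sums, each start u contributes S_u once for each of the
    W_m periods of [u, u + W_m). *)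
Lemma sum_execution m :
  \sum_(1 <= t < (horizon I).+1) execution S t m = (duration m)%:R.
Proof.
under eq_bigr do rewrite execution_by_start.
rewrite (exchange_big_dep xpredT) //=.
case: solS => /(_ m) sum1 _ _; rewrite -[RHS]mul1r -[X in X * _]sum1 mulr_suml.
rewrite big_nat [RHS]big_nat; apply: eq_bigr => u Iu.
have [-> | /(start_fits Iu) fits] := eqVneq (S u m) 0.
  by rewrite big1 // mul0r.
have -> : \sum_(1 <= t < (horizon I).+1 | (u <= t < u + duration m)%N) S u m
        = \sum_(u <= t < u + duration m) S u m.
  rewrite [RHS](big_nat_widen _ _ (horizon I).+1) //.
  rewrite [RHS](big_nat_widenl _ 1%N); last by case/andP: Iu.
  by apply: eq_bigl => t; rewrite andbC.
by rewrite sumr_const_nat addKn mulr_natr.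
Qed.

Lemma start_le_execution t t' m :
  period I t -> (t <= t' < t + duration m)%N -> S t m <= execution S t' m.
Proof.
move=> It window; rewrite execution_by_start big_mkcond /=.
rewrite (bigD1_seq t) ?iota_uniq ?mem_index_iota //= window lerDl.
rewrite big_seq_cond; apply: sumr_ge0 => u /andP[].
by rewrite mem_index_iota => Iu _; case: ifP => // _; apply: start_ge0.
Qed.

Lemma execution_increment t m :
  period I t -> execution S t m - execution S t.-1 m <= S t m.
Proof.
move=> It; rewrite lerBlDr !execution_by_start.
have It' : t \in index_iota 1 (horizon I).+1 by rewrite mem_index_iota.
rewrite big_mkcond [X in _ <= _ + X]big_mkcond /=.
rewrite (bigD1_seq t) ?iota_uniq //= [X in _ <= _ + X](bigD1_seq t) ?iota_uniq //=.
have dur := duration_gt0 m; have t_gt0 : (0 < t)%N by case/andP: It.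
have -> : (t <= t < t + duration m)%N by lia.
have -> : (t <= t.-1 < t + duration m)%N = false by lia.
rewrite add0r lerD2l.
rewrite big_seq_cond [leRHS]big_seq_cond; apply: ler_sum => u /andP[].
rewrite mem_index_iota => Iu ne_ut; have Su := @start_ge0 u m Iu.
by case: ifP; case: ifP => //; lia.
Qed.

(** The middle constraint of F5 is the sum of W_m copies of the two bounds
    X_t - X_(t-1) <= S_t <= X_t'. *)
Lemma execution_F5 : continuous_solution (@F5 R) (execution S).
Proof.
split=> [m | t m It | t m _].
- exact: sum_execution.
- rewrite padded_execution.
  under eq_bigr do rewrite padded_execution.
  apply: (@le_trans _ _ ((duration m)%:R * S t m)).
    by rewrite ler_wpM2l ?ler0n ?execution_increment.
  rewrite mulr_natl -[X in _ *+ X](addKn t) -sumr_const_nat.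
  apply: ler_sum_nat => t' window.
  exact: start_le_execution.
- by rewrite /unit_interval /= execution_ge0 execution_le1.
Qed.

End StartToExecution.

Lemma eq_F5 (R : realType) (dom : pred R) (I : instance) (X Y : assignment R I) :
  (forall t m, period I t -> X t m = Y t m) -> F5 dom X -> F5 dom Y.
Proof.
move=> eqXY [sumX rampX domX].
have eq_pad t m : padded X t m = padded Y t m.
  by rewrite /padded; case: ifP => // /(eqXY t m).
split=> [m | t m It | t m It]; last by rewrite -eqXY //; apply: domX.
- by rewrite -sumX; apply: eq_big_nat => t It; rewrite eqXY.
- rewrite -eq_pad -eqXY //.
  by under eq_bigr do rewrite -eq_pad; apply: rampX.
Qed.

(** * A flat profile separates F5 from F6 *)

Lemma card_unit_gt0 : (0 < #|{: unit}|)%N.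
Proof. by rewrite card_unit. Qed.

Definition two_of_three : instance :=
  @Instance 3 unit card_unit_gt0 (fun=> 2%N) (fun=> isT).

Definition flat_profile (R : realType) : assignment R two_of_three :=
  fun _ _ => 2 / 3.

Lemma flat_profile_F5 (R : realType) :
  continuous_solution (@F5 R) (flat_profile R).
Proof.
split=> [m | t m It | t m _].
- rewrite /flat_profile /index_iota /= !big_cons big_nil; lra.
- have {It} : t \in [:: 1; 2; 3]%N by move: It; rewrite /period !inE /=; lia.
  rewrite !inE => /or3P[] /eqP -> /=;
    rewrite /index_iota /= !big_cons big_nil /padded /flat_profile /=; lra.
- rewrite /unit_interval /flat_profile /=; lra.
Qed.

Lemma flat_profile_not_F6 (R : realType) :
  ~ continuous_solution (@F6_in_X R) (flat_profile R).
Proof.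
case=> S [[/(_ tt) sumS lateS _] /(_ 2%N tt isT)].
(* The range of sumS ends with period 3, which is too late for a start. *)
move: sumS; rewrite execution_by_start /= /flat_profile.
rewrite /index_iota /= !big_cons !big_nil /=.
rewrite (lateS 3%N tt) //; lra.
Qed.

Theorem corollary3p5 (R : realType) : strictly_tighter (@F6_in_X R) (@F5 R).
Proof.
split=> [I X [S [solS eqX]] | ].
  exact: eq_F5 eqX (execution_F5 solS).
exists two_of_three, (flat_profile R).
by split; [exact: flat_profile_F5 | exact: flat_profile_not_F6].
Qed.
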